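(* Let $K$ be a field of characteristic $p>0$ and let $f\in K[x]\setminus K$. Then every nonzero (two-sided) ideal $I$ of the algebra $\Lambda(f)=K[x][y;f\frac{d}{dx}]$ meets the centre $Z(\Lambda(f))$ of $\Lambda(f)$ nontrivially, i.e. $I\cap Z(\Lambda(f))\neq 0$.
   Context: $\Lambda(f)=K[x][y;f\frac{d}{dx}]=K\langle x,y\mid yx-xy=f\rangle=\bigoplus_{i\ge 0}K[x]y^i$ is an Ore extension. *)

(* Defs.v *)
From HB Require Import structures.
From mathcomp Require Import all_boot all_order all_algebra.

Set Implicit Arguments.
Unset Strict Implicit.
Unset Printing Implicit Defensive.

Import GRing.Theory.
Local Open Scope ring_scope.

Record derivation (R : nzRingType) := Derivation {
  der_fun :> {additive R -> R};
  derM : forall a b : R, der_fun (a * b) = der_fun a * b + a * der_fun b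
}.

(* The Ore extension R[y; d], in which y * a = a * y + d a for a in R.  As a  *)
(* left R-module it is R[y], so the polynomial with coefficients u`_i stands  *)
(* for \sum_i u`_i y^i.                                                       *)
Definition ore (R : nzRingType) (d : derivation R) : Type := {poly R}.

Section OreExtension.
Variables (R : nzRingType) (d : derivation R).
Implicit Types (a b : R) (u v w : {poly R}) (i : nat).

(* Left multiplication by y: y * (\sum_i v_i y^i) =                           *)
(* \sum_i v_i y^i.+1 + \sum_i (d v_i) y^i.                                    *)
Definition ore_lmuly v : {poly R} := v * 'X + map_poly d v.

Definition ore_mul u v : {poly R} :=
  \sum_(i < size u) u`_i *: iter i ore_lmuly v.

Lemma ore_der1 : d 1 = 0.
Proof.
have /eqP := derM d 1 1.
by rewrite !(mul1r, mulr1) -subr_eq0 opprD addNKr oppr_eq0 => /eqP.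
Qed.

Lemma ore_lmulyD : {morph ore_lmuly : u v / u + v}.
Proof. by move=> u v; rewrite /ore_lmuly mulrDl raddfD addrACA. Qed.

Lemma ore_lmuly0 : ore_lmuly 0 = 0.
Proof. by rewrite /ore_lmuly mul0r raddf0 addr0. Qed.

Lemma ore_lmuly_sum n (F : 'I_n -> {poly R}) :
  ore_lmuly (\sum_(i < n) F i) = \sum_(i < n) ore_lmuly (F i).
Proof. exact: (big_morph _ ore_lmulyD ore_lmuly0). Qed.

Lemma ore_lmulyZ a v : ore_lmuly (a *: v) = a *: ore_lmuly v + d a *: v.
Proof.
apply/polyP=> i; rewrite /ore_lmuly !(coefD, coefZ, coefMX, coef_map) /=.
rewrite derM mulrDr -addrA [d a * _ + _]addrC; congr (_ + _).
by case: i => [|i] /=; rewrite ?mulr0.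
Qed.

Lemma iter_ore_lmulyD i u v :
  iter i ore_lmuly (u + v) = iter i ore_lmuly u + iter i ore_lmuly v.
Proof. by elim: i => //= i ->; rewrite ore_lmulyD. Qed.

Lemma ore_mul_wide n u v : (size u <= n)%N ->
  ore_mul u v = \sum_(i < n) u`_i *: iter i ore_lmuly v.
Proof.
move=> le_un; rewrite /ore_mul (big_ord_widen n (fun i => u`_i *: iter i _ v)) //.
rewrite big_mkcond; apply: eq_bigr => i _; case: ltnP => // le_ui.
by rewrite nth_default // scale0r.
Qed.

Lemma ore_mulDl : left_distributive ore_mul +%R.
Proof.
move=> u v w; set n := maxn (size u) (size v).
rewrite !(@ore_mul_wide n) ?size_polyD ?leq_maxl ?leq_maxr // -big_split.
by apply: eq_bigr => i _; rewrite coefD scalerDl.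
Qed.

Lemma ore_mulDr : right_distributive ore_mul +%R.
Proof.
move=> u v w; rewrite -big_split.
by apply: eq_bigr => i _; rewrite iter_ore_lmulyD scalerDr.
Qed.

Lemma ore_mul0l v : ore_mul 0 v = 0.
Proof. by rewrite /ore_mul size_poly0 big_ord0. Qed.

Lemma ore_mulZl a u v : ore_mul (a *: u) v = a *: ore_mul u v.
Proof.
rewrite (@ore_mul_wide (size u)) ?size_scale_leq // scaler_sumr.
by apply: eq_bigr => i _; rewrite coefZ scalerA.
Qed.

Lemma ore_mulCl a v : ore_mul a%:P v = a *: v.
Proof.
by rewrite (@ore_mul_wide 1) ?size_polyC_leq1 // big_ord1 coefC.
Qed.

Lemma ore_mul1l : left_id 1 ore_mul.
Proof. by move=> v; rewrite -[1]/(1%:P) ore_mulCl scale1r. Qed.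

Lemma iter_ore_lmuly1 i : iter i ore_lmuly 1 = 'X^i.
Proof.
elim: i => [|i /= ->]; first by rewrite expr0.
rewrite /ore_lmuly -exprSr; apply/polyP=> j; rewrite coefD coef_map coefXn /=.
rewrite [X in _ + X](_ : _ = 0) ?addr0 ?coefXn //.
by case: eqP; rewrite /= ?ore_der1 ?raddf0.
Qed.

Lemma ore_mul1r : right_id 1 ore_mul.
Proof.
move=> u; rewrite /ore_mul -[RHS]coefK poly_def.
by apply: eq_bigr => i _; rewrite iter_ore_lmuly1.
Qed.

Lemma ore_mul_lmuly u v : ore_mul (ore_lmuly u) v = ore_lmuly (ore_mul u v).
Proof.
rewrite [ore_lmuly u]/ore_lmuly ore_mulDl [in RHS]/ore_mul ore_lmuly_sum.
under [RHS]eq_bigr => i _ do rewrite ore_lmulyZ.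
rewrite big_split /=; congr (_ + _).
  rewrite (@ore_mul_wide (size u).+1); last first.
    by rewrite (leq_trans (size_polyMleq _ _)) // size_polyX addn2.
  rewrite big_ord_recl coefMX scale0r add0r.
  by apply: eq_bigr => i _; rewrite coefMX.
rewrite (@ore_mul_wide (size u)) ?size_poly //.
by apply: eq_bigr => i _; rewrite coef_map.
Qed.

Lemma ore_mulA : associative ore_mul.
Proof.
move=> u v w; rewrite [LHS]/ore_mul [ore_mul u v]/ore_mul.
rewrite (big_morph (ore_mul^~ w) (fun u1 u2 => ore_mulDl u1 u2 w)
  (ore_mul0l w)).
apply: eq_bigr => i _; rewrite ore_mulZl; congr (_ *: _).
by elim: (i : nat) => //= k ->; rewrite ore_mul_lmuly.
Qed.

End OreExtension.

HB.instance Definition _ (R : nzRingType) (d : derivation R) :=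
  GRing.Zmodule.copy (ore d) {poly R}.
HB.instance Definition _ (R : nzRingType) (d : derivation R) :=
  GRing.Zmodule_isNzRing.Build (ore d) (@ore_mulA R d)
    (@ore_mul1l R d) (@ore_mul1r R d) (@ore_mulDl R d) (@ore_mulDr R d)
    (oner_neq0 {poly R}).

Section Generators.
Variables (R : nzRingType) (d : derivation R).

Definition ore_const (a : R) : ore d := a%:P.
Definition ore_var : ore d := 'X.

Lemma ore_constM a b : ore_const (a * b) = ore_const a * ore_const b.
Proof.
by rewrite [RHS]ore_mulCl /ore_const -mul_polyC -polyCM.
Qed.

Lemma ore_var_const a :
  ore_var * ore_const a = ore_const a * ore_var + ore_const (d a).
Proof.
rewrite [ore_const a * _]ore_mulCl [LHS](@ore_mul_wide _ _ 2) ?size_polyX //.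
rewrite big_ord_recl big_ord1 !coefX /= scale0r scale1r add0r.
by rewrite /ore_lmuly map_polyC mul_polyC.
Qed.

Lemma ore_varX i : ore_var ^+ i = 'X^i :> {poly R}.
Proof.
elim: i => [|i IH]; first by rewrite expr0.
rewrite exprS [LHS](@ore_mul_wide _ _ 2) ?size_polyX //.
rewrite big_ord_recl big_ord1 !coefX /= scale0r scale1r add0r IH.
by rewrite -!(iter_ore_lmuly1 d).
Qed.

(* R[y; d] is the direct sum of the R y^i; uniqueness of the coefficients is  *)
(* that of polynomial coefficients.                                           *)
Lemma ore_sumE (u : ore d) :
  u = \sum_(i < size (u : {poly R})) ore_const (u : {poly R})`_i * ore_var ^+ i.
Proof.
rewrite -[LHS]coefK poly_def.
by apply: eq_bigr => i _; rewrite [RHS]ore_mulCl ore_varX.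
Qed.

End Generators.

Section Lambda.
Variables (K : fieldType) (f : {poly K}).

Definition fddx (q : {poly K}) : {poly K} := f * q^`().

Lemma fddx_is_additive : zmod_morphism fddx.
Proof. by move=> q r; rewrite /fddx derivB mulrBr. Qed.
HB.instance Definition _ :=
  GRing.isZmodMorphism.Build {poly K} {poly K} fddx fddx_is_additive.

Lemma fddxM (q r : {poly K}) : fddx (q * r) = fddx q * r + q * fddx r.
Proof. by rewrite /fddx derivM mulrDr mulrA mulrCA. Qed.

Definition fddx_derivation : derivation {poly K} := Derivation fddxM.

Definition Lambda : Type := ore fddx_derivation.

HB.instance Definition _ := GRing.NzRing.copy Lambda (ore fddx_derivation).

Definition Lambda_x : Lambda := ore_const fddx_derivation 'X.
Definition Lambda_y : Lambda := ore_var fddx_derivation.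
Definition Lambda_poly (q : {poly K}) : Lambda := ore_const fddx_derivation q.

Lemma Lambda_rel :
  Lambda_y * Lambda_x - Lambda_x * Lambda_y = Lambda_poly f.
Proof.
apply/eqP; rewrite subr_eq addrC; apply/eqP.
rewrite [LHS]ore_var_const; congr (_ + _).
by rewrite /= /fddx derivX mulr1.
Qed.

Definition Lambda_scale (c : K) (u : Lambda) : Lambda := Lambda_poly c%:P * u.

Lemma Lambda_scaleA a b u :
  Lambda_scale a (Lambda_scale b u) = Lambda_scale (a * b) u.
Proof. by rewrite /Lambda_scale mulrA polyCM [in RHS]/Lambda_poly ore_constM. Qed.

Lemma Lambda_scale1 : left_id 1 Lambda_scale.
Proof. by move=> u; rewrite /Lambda_scale -[RHS]mul1r. Qed.

Lemma Lambda_scaleDr : right_distributive Lambda_scale +%R.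
Proof. by move=> a u v; rewrite /Lambda_scale mulrDr. Qed.

Lemma Lambda_scaleDl u : {morph Lambda_scale^~ u : a b / a + b}.
Proof.
move=> a b; rewrite /Lambda_scale -mulrDl; congr (_ * _).
by rewrite /Lambda_poly /ore_const !polyCD.
Qed.

HB.instance Definition _ := GRing.Zmodule_isLmodule.Build K Lambda
  Lambda_scaleA Lambda_scale1 Lambda_scaleDr Lambda_scaleDl.

Lemma Lambda_scaleAl (a : K) (u v : Lambda) : a *: (u * v) = (a *: u) * v.
Proof. exact: mulrA. Qed.

HB.instance Definition _ :=
  GRing.Lmodule_isLalgebra.Build K Lambda Lambda_scaleAl.

Lemma Lambda_polyC_comm (c : K) (u : Lambda) :
  GRing.comm (Lambda_poly c%:P) u.
Proof.
have yc : GRing.comm (Lambda_poly c%:P) Lambda_y.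
  apply/esym; rewrite [LHS]ore_var_const /= /fddx derivC mulr0.
  by rewrite [X in _ + X](_ : _ = 0) ?addr0.
rewrite [u]ore_sumE; apply: commr_sum => i _; apply: commrM.
  by rewrite /GRing.comm -!ore_constM mulrC.
exact: commrX.
Qed.

Lemma Lambda_scaleAr (a : K) (u v : Lambda) : a *: (u * v) = u * (a *: v).
Proof. by rewrite /GRing.scale /= /Lambda_scale mulrA Lambda_polyC_comm mulrA. Qed.

HB.instance Definition _ :=
  GRing.Lalgebra_isAlgebra.Build K Lambda Lambda_scaleAr.

End Lambda.

(* Stability under K-scaling follows from absorption, since a *: u = a%:A * u. *)
Record two_sided_ideal (A : nzRingType) (I : A -> Prop) : Prop :=
  TwoSidedIdeal {
    ideal0 : I 0;
    idealB : forall u v, I u -> I v -> I (u - v);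
    idealMl : forall a u, I u -> I (a * u);
    idealMr : forall a u, I u -> I (u * a)
  }.

Definition in_center (A : nzRingType) (z : A) : Prop :=
  forall u : A, GRing.comm z u.

(* Main.v *)
(* If u is a nonzero element of I of minimal degree in y, with leading         *)
(* coefficient a, then z = a^(p-1) u has leading coefficient a^p, which the    *)
(* derivation kills in characteristic p. Hence the commutators of z with y and *)
(* with the elements of the coefficient ring have smaller degree than z; they  *)
(* lie in I, so they vanish by minimality, and z is central.                   *)
Require Import Defs.
From Stdlib Require Import Classical_Prop.
From HB Require Import structures.
From mathcomp Require Import all_boot all_order all_algebra.

Set Implicit Arguments.
Unset Strict Implicit.
Unset Printing Implicit Defensive.

Import GRing.Theory.
Local Open Scope ring_scope.

(** The argument works over any commutative domain of characteristic p; here R = K[x]. The size of a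
    polynomial measures degree in y. Commutators with coefficients always lower it
    ([size_ore_commutator_const]), those with y do once d kills the leading coefficient
    ([size_ore_commutator_var]), and d(a^p) = p a^(p-1) d(a) = 0 ([derX]). Coefficients and y
    generate the ring, so commuting with them suffices ([ore_in_center]). *)

Lemma size_iter_ore_lmuly_const (R : nzRingType) (d : derivation R) i (b : R) :
  (size (iter i (ore_lmuly d) b%:P) <= i.+1)%N.
Proof.
elim: i => [|i IH] /=; first exact: size_polyC_leq1.
rewrite (leq_trans (size_polyD _ _)) // geq_max.
rewrite (leq_trans (size_polyMleq _ _)) ?size_polyX ?addn2 //=.
by rewrite (leq_trans (size_poly _ _)) // (leq_trans IH).
Qed.

(** With the size bound: y^i b = b y^i + lower terms, since derivatives of b only appear below the
    top degree. *)
Lemma coef_iter_ore_lmuly_const (R : nzRingType) (d : derivation R) i (b : R) :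
  (iter i (ore_lmuly d) b%:P)`_i = b.
Proof.
elim: i => [|i IH] /=; first by rewrite coefC.
rewrite /ore_lmuly coefD coefMX /= IH coef_map /= nth_default ?raddf0 ?addr0 //.
exact: size_iter_ore_lmuly_const.
Qed.

Lemma ore_mulX (R : nzRingType) (d : derivation R) (u : {poly R}) :
  ore_mul d u 'X = u * 'X.
Proof.
have iterX i : iter i (ore_lmuly d) 'X = 'X^(i.+1).
  rewrite -(iter_ore_lmuly1 d i.+1) iterSr -[ore_lmuly d 1]/(iter 1 _ 1).
  by rewrite iter_ore_lmuly1.
rewrite /ore_mul -[in RHS](coefK u) poly_def mulr_suml.
by apply: eq_bigr => i _; rewrite iterX exprSr scalerAl.
Qed.

Lemma ore_mulXl (R : nzRingType) (d : derivation R) (u : {poly R}) :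
  ore_mul d 'X u = ore_lmuly d u.
Proof.
have -> : 'X = ore_lmuly d 1 by exact/esym/(iter_ore_lmuly1 d 1).
by rewrite ore_mul_lmuly ore_mul1l.
Qed.

(** For u = a y^n + ..., the top terms a b y^n and b a y^n cancel because R is commutative. *)
Lemma size_ore_commutator_const (R : comNzRingType) (d : derivation R)
    (u : {poly R}) (b : R) :
  u != 0 -> (size (ore_mul d u b%:P - b *: u)%R < size u)%N.
Proof.
rewrite -size_poly_gt0; case def_n: (size u) => [|n] // _; rewrite ltnS.
apply/leq_sizeP => j le_nj.
rewrite coefB coefZ (@ore_mul_wide _ _ n.+1) ?def_n // coef_sum big_ord_recr /=.
have coef0 i : (i < j)%N -> (iter i (ore_lmuly d) b%:P)`_j = 0.
  by move=> lt_ij; rewrite nth_default // (leq_trans (size_iter_ore_lmuly_const _ _ _)).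
rewrite big1 => [|i _]; last first.
  by rewrite coefZ coef0 ?mulr0 // (leq_trans (ltn_ord i)).
rewrite add0r coefZ; case: ltngtP le_nj => // [lt_nj|<-] _.
  by rewrite coef0 // [u`_j]nth_default ?def_n // !mulr0 subr0.
by rewrite coef_iter_ore_lmuly_const mulrC subrr.
Qed.

(** The commutator yu - uy is d applied to each coefficient of u. *)
Lemma size_ore_commutator_var (R : nzRingType) (d : derivation R)
    (u : {poly R}) :
  u != 0 -> d (lead_coef u) = 0 ->
  (size (ore_mul d 'X u - ore_mul d u 'X)%R < size u)%N.
Proof.
rewrite -size_poly_gt0 lead_coefE ore_mulXl ore_mulX /ore_lmuly addrAC subrr add0r.
case def_n: (size u) => [|n] //= _ da0; rewrite ltnS; apply/leq_sizeP => j.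
rewrite coef_map /=; case: ltngtP => // [lt_nj|<-] _ //.
by rewrite nth_default ?raddf0 ?def_n.
Qed.

Lemma derX (R : comNzRingType) (d : derivation R) (a : R) n :
  d (a ^+ n) = a ^+ n.-1 * d a *+ n.
Proof.
elim: n => [|[|n] IH]; first by rewrite expr0 ore_der1.
  by rewrite expr1 expr0 mul1r.
by rewrite exprS derM IH mulrnAr mulrA -exprS /= mulrC -mulrS.
Qed.

Lemma ore_in_center (R : nzRingType) (d : derivation R) (z : ore d) :
  (forall b, GRing.comm z (ore_const d b)) -> GRing.comm z (ore_var d) ->
  in_center z.
Proof.
move=> zR zy u; rewrite [u]ore_sumE; apply: commr_sum => i _.
by apply: commrM; last exact: commrX.
Qed.

Theorem ore_ideal_meets_center (R : idomainType) (p : nat)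
    (charRp : p \in [pchar R]) (d : derivation R) (I : ore d -> Prop)
    (idealI : two_sided_ideal I) (u : ore d) :
  I u -> u <> 0 -> exists z : ore d, [/\ I z, in_center z & z <> 0].
Proof.
have [n] := ubnP (size (u : {poly R})); elim: n u => // n IH u le_un Iu u_neq0.
(* I is an arbitrary predicate, so minimality of u is decided by excluded middle. *)
have [[v [Iv v_neq0 lt_vu]]|u_min] := classic
  (exists v, [/\ I v, v <> 0 & (size (v : {poly R}) < size (u : {poly R}))%N]).
  by apply: (IH v) => //; rewrite (leq_trans lt_vu).
have min0 v : I v -> (size (v : {poly R}) < size (u : {poly R}))%N -> v = 0.
  by move=> Iv lt_vu; apply: NNPP => v_neq0; apply: u_min; exists v.
have {}u_neq0 : (u : {poly R}) != 0 by apply/eqP.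
pose a := lead_coef (u : {poly R}).
have a_neq0 : a != 0 by rewrite lead_coef_eq0.
pose z : ore d := ore_const d (a ^+ p.-1) * u.
have zE : z = a ^+ p.-1 *: (u : {poly R}) by exact: ore_mulCl.
have Iz : I z by exact: idealMl.
have ap_neq0 : a ^+ p.-1 != 0 by rewrite expf_neq0.
(* No zero divisors: scaling by a^(p-1) keeps the degree, so z is minimal too. *)
have size_z : size (z : {poly R}) = size (u : {poly R}).
  by rewrite zE size_scale.
have z_neq0 : (z : {poly R}) != 0 by rewrite -size_poly_eq0 size_z size_poly_eq0.
have dz0 : d (lead_coef (z : {poly R})) = 0.
  rewrite zE lead_coefZ -/a -exprSr prednK ?prime_gt0 ?(pcharf_prime charRp) //.
  by rewrite derX -mulr_natr (pcharf0 charRp) mulr0.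
exists z; split=> //; last exact/eqP.
apply: ore_in_center => [b|]; apply/eqP; rewrite -subr_eq0; apply/eqP.
  apply: min0; first by apply: idealB => //; [exact: Defs.idealMr | exact: idealMl].
  rewrite [ore_const d b * z]ore_mulCl -size_z.
  exact: size_ore_commutator_const.
(* The sign is flipped to reach yz - zy, the form with the degree bound. *)
apply/eqP; rewrite -oppr_eq0 opprB; apply/eqP.
apply: min0; first by apply: idealB => //; [exact: idealMl | exact: Defs.idealMr].
by rewrite -size_z; exact: size_ore_commutator_var.
Qed.

Theorem corollary2p2 (K : fieldType) (p : nat) (hp : p \in [pchar K])
    (f : {poly K}) (hf : ~ exists c : K, f = c%:P)
    (I : Lambda f -> Prop) (hI : two_sided_ideal I)
    (hI0 : exists u : Lambda f, I u /\ u <> 0) :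
  exists z : Lambda f, [/\ I z, in_center z & z <> 0].
Proof.
have [u [Iu u_neq0]] := hI0.
have charKX : p \in [pchar {poly K}] by rewrite pchar_poly.
exact: (ore_ideal_meets_center charKX hI Iu u_neq0).
Qed.
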